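(* Let $V\subseteq\mathbb{R}^d\setminus\{0\}$ be a nonempty finite set such that no two points of $V$ lie in a common 1-dimensional linear subspace. Let $E$ be a finite multiset of triples $\{u,v,w\}$ of distinct points of $V$ lying in a common 2-dimensional linear subspace. Suppose that for every $V'\subseteq V$ with $\dim\operatorname{span}V'\le2$, the number (with multiplicity) of triples of $E$ contained in $V'$ is at most $|V'|-1$. Then for every $\lambda>0$ there exists $V'\subseteq V$ such that, letting $E'$ be the multiset of triples of $E$ contained in $V'$, we have $|E|-|E'|<\lambda|V|$ and $\dim\operatorname{span}V'\le 12|V|/\lambda$. *)

(* Defs.v *)
From HB Require Import structures.
From mathcomp Require Import all_boot all_order all_algebra.
From mathcomp Require Import finmap.
From mathcomp Require Import reals.
Set Implicit Arguments. Unset Strict Implicit. Unset Printing Implicit Defensive.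
Import Order.TTheory GRing.Theory Num.Theory.
Local Open Scope ring_scope.
Local Open Scope fset_scope.

Definition spandim (R : realType) (d : nat) (S : {fset 'rV[R]_d}) : nat :=
  \dim <<(S : seq 'rV[R]_d)>>%VS.

Definition ntriples_in (R : realType) (d : nat)
  (E : seq {fset 'rV[R]_d}) (S : {fset 'rV[R]_d}) : nat :=
  count (fun e => e `<=` S) E.

(* Main.v *)
Require Import Defs.
From HB Require Import structures.
From mathcomp Require Import all_boot all_order all_algebra.
From mathcomp Require Import fingroup perm finmap.
From mathcomp Require Import boolp reals.
From mathcomp Require sequences exp.
From mathcomp Require Import zify ring lra.
Import Order.TTheory GRing.Theory Num.Theory.
Local Open Scope ring_scope.

(** If lambda <= 12, take V' = V.  Otherwise let s be the least integer above
    lambda / 12, so s < lambda / 6, and let W be a subspace maximising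
    |V \cap W| - s dim W.  Then dim W <= |V| / s, and the images of
    the points of V \ W in the quotient by W have density at most s: every
    subspace U contains at most s dim U of them.  For such vectors, minimising
    prod |z T|^2 / det(T)^(2s) over contractions T (bounded below by a greedy
    basis argument and Leibniz' formula for the determinant) puts them in nearly
    isotropic position: sum_u cos^2(u, v) <= 4 s for every v.  On the other hand
    a plane P containing a triple that is not inside W contributes at least
    3/4 (|V \cap P| - 1) to the sum of cos^2 over pairs of distinct points: if P
    meets W trivially since k unit vectors of a plane satisfy
    sum <y, y'>^2 >= k^2 / 2, and otherwise since all points of P outside W
    become parallel in the quotient.  A pair of points lies in a single plane, so
    at most (4/3) 4 s |V| < lambda |V| triples are not contained in W. *)

Set Implicit Arguments.
Unset Strict Implicit.
Unset Printing Implicit Defensive.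

(** * Inner product and squared cosines *)

Definition dot (R : realType) (d : nat) (u v : 'rV[R]_d) : R := (u *m v^T) 0 0.

Lemma dotE (R : realType) (d : nat) (u v : 'rV[R]_d) :
  dot u v = \sum_i u 0 i * v 0 i.
Proof. by rewrite /dot mxE; apply: eq_bigr => i _; rewrite mxE. Qed.

Lemma dotC (R : realType) (d : nat) (u v : 'rV[R]_d) : dot u v = dot v u.
Proof. by rewrite !dotE; apply: eq_bigr => i _; rewrite mulrC. Qed.

Lemma dotDl (R : realType) (d : nat) (u v w : 'rV[R]_d) :
  dot (u + v) w = dot u w + dot v w.
Proof. by rewrite /dot mulmxDl mxE. Qed.

Lemma dotZl (R : realType) (d : nat) (a : R) (u w : 'rV[R]_d) :
  dot (a *: u) w = a * dot u w.
Proof. by rewrite /dot -scalemxAl mxE. Qed.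

Lemma dotDr (R : realType) (d : nat) (u v w : 'rV[R]_d) :
  dot w (u + v) = dot w u + dot w v.
Proof. by rewrite dotC dotDl !(dotC w). Qed.

Lemma dotZr (R : realType) (d : nat) (a : R) (u w : 'rV[R]_d) :
  dot w (a *: u) = a * dot w u.
Proof. by rewrite dotC dotZl dotC. Qed.

Lemma dot_ge0 (R : realType) (d : nat) (u : 'rV[R]_d) : 0 <= dot u u.
Proof. by rewrite dotE sumr_ge0 // => i _; rewrite -expr2 sqr_ge0. Qed.

Lemma dot_gt0 (R : realType) (d : nat) (u : 'rV[R]_d) : (0 < dot u u) = (u != 0).
Proof.
rewrite lt_def dot_ge0 andbT; congr negb; apply/eqP/eqP => [|->]; last first.
  by rewrite /dot mul0mx mxE.
rewrite dotE => /psumr_eq0P h; apply/rowP => i; rewrite mxE.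
by apply/eqP; rewrite -sqrf_eq0 expr2 h // => j _; rewrite -expr2 sqr_ge0.
Qed.

Lemma sqr_entry_le_dot (R : realType) (d : nat) (u : 'rV[R]_d) (i : 'I_d) :
  u 0 i ^+ 2 <= dot u u.
Proof.
rewrite dotE (bigD1 i) //= -expr2 lerDl.
by apply: sumr_ge0 => j _; rewrite -expr2 sqr_ge0.
Qed.

Lemma Cauchy_Schwarz_dot (R : realType) (d : nat) (u v : 'rV[R]_d) :
  dot u v ^+ 2 <= dot u u * dot v v.
Proof.
have [->|v0] := eqVneq v 0.
  by rewrite dotC /dot !mul0mx !mxE expr0n /= mulr0.
have v0' : 0 < dot v v by rewrite dot_gt0.
(* This vector is [dot v v] times the component of [u] orthogonal to [v]. *)
have := dot_ge0 (dot v v *: u + (- dot u v) *: v).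
rewrite !(dotDl, dotDr, dotZl, dotZr) (dotC v u).
set a := dot u u; set b := dot u v; set c := dot v v.
rewrite (_ : _ + _ = c * (a * c - b ^+ 2)); last by ring.
by rewrite pmulr_rge0 // subr_ge0.
Qed.

(* Equal to 0, as x / 0 = 0, when one of the vectors is 0. *)
Definition cos2 (R : realType) (d : nat) (u v : 'rV[R]_d) : R :=
  dot u v ^+ 2 / (dot u u * dot v v).

Lemma cos2C (R : realType) (d : nat) (u v : 'rV[R]_d) : cos2 u v = cos2 v u.
Proof. by rewrite /cos2 (dotC u v) mulrC [dot u u * _]mulrC mulrC. Qed.

Lemma cos20 (R : realType) (d : nat) (v : 'rV[R]_d) : cos2 0 v = 0.
Proof. by rewrite /cos2 /dot !mul0mx !mxE expr0n mul0r. Qed.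

Lemma cos2_ge0 (R : realType) (d : nat) (u v : 'rV[R]_d) : 0 <= cos2 u v.
Proof. by rewrite divr_ge0 ?sqr_ge0 // mulr_ge0 // dot_ge0. Qed.

Lemma cos2_parallel (R : realType) (d : nat) (p u v : 'rV[R]_d) :
  u \in <[p]>%VS -> v \in <[p]>%VS -> u != 0 -> v != 0 -> cos2 u v = 1.
Proof.
move=> /vlineP[a ->] /vlineP[b ->]; rewrite !scaler_eq0 !negb_or.
move=> /andP[a0 p0] /andP[b0 _]; rewrite /cos2 !(dotZl, dotZr).
have d0 : dot p p != 0 by rewrite lt0r_neq0 // dot_gt0.
by field; rewrite a0 b0 d0.
Qed.

Lemma cos2_diag (R : realType) (d : nat) (u : 'rV[R]_d) : u != 0 -> cos2 u u = 1.
Proof. by move=> u0; apply: (@cos2_parallel _ _ u); rewrite ?memv_line. Qed.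

(** * Greedy bases and a lower bound for products of squared lengths *)

Lemma dim_le_ambient (R : realType) (d : nat) (U : {vspace 'rV[R]_d}) :
  (\dim U <= d)%N.
Proof. by have := dimvS (subvf U); rewrite dimvf dim_matrix mul1r. Qed.

(** At [U = 0] the density bound leaves no room for a zero vector. *)
Lemma density_neq0 (R : realType) (d s : nat) (l : seq 'rV[R]_d) :
  (forall U : {vspace 'rV[R]_d}, (count (fun z => z \in U) l <= s * \dim U)%N) ->
  forall z, z \in l -> z != 0.
Proof.
move=> cnt z zl; apply/eqP => z0; have := cnt 0%VS.
rewrite dimv0 muln0 leqNgt -has_count => /negP; apply.
by apply/hasP; exists z => //; rewrite z0 mem0v.
Qed.

(* Scanning the list from its smallest weight upwards, the k-th vector has weight
   at least that of the (ceil (k / s))-th vector of the greedy basis, because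
   the first k vectors span dimension at least k / s.  The powers of the upper
   bound [c] pay for the slots left unused. *)
Lemma greedy_basis (R : realType) (d : nat) (w : 'rV[R]_d -> R) (s : nat)
    (l : seq 'rV[R]_d) (c : R) :
  (forall z, z \in l -> 0 < w z) -> sorted (fun x y => w y <= w x) l ->
  (forall U : {vspace 'rV[R]_d}, (count (fun z => z \in U) l <= s * \dim U)%N) ->
  (forall z, z \in l -> w z <= c) -> 0 < c ->
  exists B, [/\ subseq B l, free B, <<B>>%VS = <<l>>%VS &
     \prod_(b <- B) w b ^+ s <= \prod_(z <- l) w z * c ^+ (s * \dim <<l>> - size l)].
Proof.
elim: l c => [|x l IH] c wpos srt cnt wc c0.
  exists [::]; split => //; first exact: nil_free.
  by rewrite !big_nil mul1r span_nil dimv0 muln0 expr0.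
have wx0 : 0 < w x by apply: wpos; rewrite inE eqxx.
have wlx z : z \in l -> w z <= w x.
  move=> zl; move: srt; rewrite /= path_sortedE; last by move=> y1 y2 y3 h1 h2; apply: le_trans h2 h1.
  by case/andP => /allP/(_ _ zl).
(* The head has the largest weight, so [w x] can serve as the bound [c] for the tail. *)
have [] := IH (w x) => //.
- by move=> z zl; apply: wpos; rewrite inE zl orbT.
- exact: path_sorted srt.
- by move=> U; apply: leq_trans (cnt U); rewrite /= leq_addl.
move=> B [sB fB spB hB].
have cntl : (size l <= s * \dim <<l>>)%N.
  have := cnt <<l>>%VS; apply: leq_trans; rewrite /=.
  have -> : count (fun z => z \in <<l>>%VS) l = size l.
    by apply/eqP; rewrite -all_count; apply/allP => z; apply: memv_span.
  exact: leq_addl.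
have cntxl : (size (x :: l) <= s * \dim <<x :: l>>)%N.
  have := cnt <<x :: l>>%VS; apply: leq_trans.
  have -> : count (fun z => z \in <<x :: l>>%VS) (x :: l) = size (x :: l).
    by apply/eqP; rewrite -all_count; apply/allP => z; apply: memv_span.
  by [].
have wxc : w x <= c by apply: wc; rewrite inE eqxx.
have P0 : 0 <= \prod_(z <- l) w z.
  by rewrite big_seq prodr_ge0 // => z zl; apply/ltW/wpos; rewrite inE zl orbT.
have [xl|xl] := boolP (x \in <<l>>%VS).
  have spE : <<x :: l>>%VS = <<l>>%VS.
    by rewrite span_cons; apply/addv_idPr; rewrite -memvE.
  rewrite spE in cntxl *.
  exists B; split => //; first by apply: subseq_trans sB (subseq_cons _ _).
  apply: le_trans hB _; rewrite big_cons /=.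
  have -> : (s * \dim <<l>> - size l)%N = (s * \dim <<l>> - (size l).+1).+1.
    by move: cntxl => /=; lia.
  rewrite exprS mulrCA mulrA.
  apply: ler_wpM2l; first by rewrite mulr_ge0 // ltW.
  by apply: lerXn2r; rewrite ?nnegrE // ltW.
exists (x :: B); split.
- by rewrite /= eqxx.
- by rewrite free_cons spB xl.
- by rewrite !span_cons spB.
rewrite !big_cons.
have dE : \dim <<x :: l>> = (\dim <<l>>).+1.
  apply/eqP; rewrite span_cons eqn_leq; apply/andP; split.
    have [/leq_trans -> //] := dimv_add_leqif <[x]> <<l>>.
    by rewrite dim_vline; case: (x != 0).
  have := dimv_leqif_sup (addvSr <[x]> <<l>>).
  case=> h1 h2; rewrite ltn_neqAle h1 andbT h2.
  apply: contra xl => h; apply: (subvP h); apply: (subvP (addvSl _ _)).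
  exact: memv_line.
rewrite dE in cntxl *.
apply: le_trans (_ : w x ^+ s * (\prod_(z <- l) w z * w x ^+ (s * \dim <<l>> - size l)) <= _).
  by rewrite ler_wpM2l // exprn_ge0 // ltW.
rewrite mulrCA -exprD mulrAC mulrC ler_wpM2r //.
have -> : (s + (s * \dim <<l>> - size l))%N = (s * (\dim <<l>>).+1 - size (x :: l)).+1.
  by move: cntxl => /=; rewrite mulnS; lia.
rewrite exprS; apply: ler_wpM2l; first exact: ltW.
by apply: lerXn2r; rewrite ?nnegrE // ltW.
Qed.

(** Each of the [d!] terms of Leibniz' formula is at most the product of the row lengths. This is
    weaker than Hadamard's inequality, but any constant independent of [A] will do. *)
Lemma det_sqr_le (R : realType) (d : nat) (A : 'M[R]_d) :
  \det A ^+ 2 <= d`!%:R ^+ 2 * \prod_i dot (row i A) (row i A).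
Proof.
pose h i := Num.sqrt (dot (row i A) (row i A)).
have hle : `|\det A| <= d`!%:R * \prod_i h i.
  apply: le_trans (ler_norm_sum _ _ _) _.
  apply: le_trans (_ : \sum_(s : {perm 'I_d}) \prod_i h i <= _); last first.
    by rewrite sumr_const card_Sn mulr_natl.
  apply: ler_sum => s _; rewrite normrM normr_sign mul1r normr_prod.
  apply: ler_prod => i _; rewrite normr_ge0 /= -sqrtr_sqr ler_wsqrtr //.
  by have := sqr_entry_le_dot (row i A) (s i); rewrite mxE.
rewrite -[leLHS]real_normK ?num_real //.
apply: le_trans (_ : (d`!%:R * \prod_i h i) ^+ 2 <= _).
  by apply: lerXn2r => //; rewrite nnegrE; apply: le_trans hle.
rewrite exprMn -prodrXl; apply: ler_wpM2l; first exact: sqr_ge0.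
by apply: ler_prod => i _; rewrite sqr_ge0 sqr_sqrtr ?dot_ge0 /=.
Qed.

(** Complete [B] to a basis [X] with matrix [M] and apply [det_sqr_le] to [M *m T]. The contraction
    [T] does not lengthen the added vectors, so their contribution is bounded independently of
    [T]. *)
Lemma free_det_bound (R : realType) (d : nat) (B : seq 'rV[R]_d) :
  free B -> exists2 k : R, 0 < k & forall T : 'M[R]_d,
    (forall z, dot (z *m T) (z *m T) <= dot z z) ->
    k * \det T ^+ 2 <= \prod_(b <- B) dot (b *m T) (b *m T).
Proof.
move=> fB; pose B' := vbasis (<<B>>^C)%VS; pose X := B ++ B'.
have bX : basis_of fullv X.
  rewrite -(addv_complf <<B>>); apply: cat_basis.
  - exact/directv_addP/capv_compl.
  - by rewrite /basis_of eqxx.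
  - exact: vbasisP.
have sX : size X == d.
  by have := @size_basis _ _ _ _ (in_tuple X) bX; rewrite dimvf dim_matrix mul1r => /eqP; rewrite eq_sym.
pose X' := Tuple sX.
pose M := \matrix_(i < d) X'`_i : 'M[R]_d.
(* The coordinates of the unit vectors in the basis [X] form a left inverse of [M]. *)
have Mu : M \in unitmx.
  pose C := \matrix_(j < d, i < d) coord X' i (delta_mx 0 j).
  suff : C *m M = 1%:M by move/mulmx1_unit => [].
  apply/row_matrixP => j; rewrite row_mul mulmx_sum_row [RHS]rowE mulmx1.
  rewrite [RHS](@coord_span _ _ _ X' (delta_mx 0 j)) ?(span_basis bX) ?memvf //.
  by apply: eq_bigr => i _; rewrite !mxE rowK.
have dM0 : 0 < \det M ^+ 2 by rewrite exprn_even_gt0 //= -unitfE -unitmxE.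
have B'0 b : b \in B' -> 0 < dot b b.
  by move=> bB; rewrite dot_gt0; apply: free_not0 (basis_free (vbasisP _)) bB.
have D0 : 0 < \prod_(b <- B') dot b b.
  by rewrite big_seq; apply: prodr_gt0 => b /B'0.
have F0 : 0 < d`!%:R ^+ 2 :> R by rewrite exprn_gt0 // ltr0n fact_gt0.
exists (\det M ^+ 2 / (d`!%:R ^+ 2 * \prod_(b <- B') dot b b)).
  by apply: divr_gt0 => //; apply: mulr_gt0.
move=> T cT; rewrite mulrAC ler_pdivrMr; last exact: mulr_gt0.
rewrite -exprMn -det_mulmx.
apply: le_trans (det_sqr_le _) _; rewrite [leRHS]mulrCA.
apply: ler_wpM2l; first exact: ltW.
have -> : \prod_i dot (row i (M *m T)) (row i (M *m T)) =
    \prod_(b <- X) dot (b *m T) (b *m T).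
  rewrite (big_nth 0) big_mkord (eqP sX); apply: eq_bigr => i _.
  by rewrite row_mul rowK.
rewrite big_cat /=; apply: ler_wpM2l.
  by apply: prodr_ge0 => b _; apply: dot_ge0.
by apply: ler_prod => b _; rewrite dot_ge0 /=.
Qed.

(** A minimum of finitely many positive constants is positive. This makes the constant of
    [free_det_bound] uniform over all sublists of a list. *)
Lemma uniform_pos (R : realType) (F : finType) (P : F -> R -> Prop) :
  (forall m k k', k <= k' -> P m k' -> P m k) ->
  (forall m, exists2 k, 0 < k & P m k) -> exists2 k, 0 < k & forall m, P m k.
Proof.
move=> mono ex.
have /boolp.choice [k hk] m : exists k, 0 < k /\ P m k.
  by have [k k0 Pk] := ex m; exists k.
exists (\big[Num.min/1]_m k m).
  by apply/Order.TotalTheory.bigmin_gtP; split => // m _; case: (hk m).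
move=> m; apply: mono (hk m).2; exact: bigmin_le_cond.
Qed.

Lemma prod_lower_bound (R : realType) (d s : nat) (l : seq 'rV[R]_d) :
  (forall U : {vspace 'rV[R]_d}, (count (fun z => z \in U) l <= s * \dim U)%N) ->
  exists2 k : R, 0 < k & forall T : 'M[R]_d, T \in unitmx ->
    (forall z, dot (z *m T) (z *m T) <= dot z z) ->
    k * (\det T ^+ 2) ^+ s <= \prod_(z <- l) dot (z *m T) (z *m T).
Proof.
move=> cnt.
have l0 := density_neq0 cnt.
pose c : R := 1 + \sum_(z <- l) dot z z.
have c1 : 1 <= c by rewrite lerDl sumr_ge0 // => z _; exact: dot_ge0.
have c0 : 0 < c by apply: lt_le_trans c1.
pose contr (T : 'M[R]_d) := forall z, dot (z *m T) (z *m T) <= dot z z.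
(* The greedy basis depends on [T], but up to order it is one of the finitely many sublists of [l],
   each given by a mask. *)
have [||k k0 hk] := @uniform_pos R ((size l).-tuple bool)
  (fun m k => free (mask m l) -> forall T, contr T ->
     k * \det T ^+ 2 <= \prod_(b <- mask m l) dot (b *m T) (b *m T)).
- move=> m k1 k2 k12 h fm T cT; apply: le_trans (h fm T cT).
  by apply: ler_wpM2r => //; apply: sqr_ge0.
- move=> m; have [fm|fm] := boolP (free (mask m l)).
    by have [k k0 hk] := free_det_bound fm; exists k.
  by exists 1.
(* The exponent of [c] in [greedy_basis] is at most [s * d], and [c >= 1]. *)
exists (k ^+ s / c ^+ (s * d)); first by apply: divr_gt0; apply: exprn_gt0.
move=> T Tu cT; pose w z := dot (z *m T) (z *m T).
pose l' := sort (fun x y => w y <= w x) l.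
have pl : perm_eq l' l by rewrite perm_sort.
have ml z : (z \in l') = (z \in l) by apply: perm_mem.
have [|||||B [sB fB spB hB]] := @greedy_basis R d w s l' c.
+ move=> z; rewrite ml => /l0 z0; rewrite dot_gt0.
  by apply: contra z0 => /eqP h; rewrite -(mulmxK Tu z) h mul0mx.
+ by apply: sort_sorted => x y; apply: le_total.
+ by move=> U; rewrite (seq.permP pl).
+ move=> z; rewrite ml => zl; apply: le_trans (cT z) _.
  rewrite /c (big_rem z zl) /= addrCA lerDl addr_ge0 //.
  by apply: sumr_ge0 => y _; apply: dot_ge0.
+ by [].
(* [B] is a sublist of the sorted list; [B0] is a rearrangement of it that is a sublist of [l]. *)
have [|B0 sB0 pB] := (count_subseqP B l).1.
  by move=> x; rewrite -(seq.permP pl); apply: (count_subseqP B l').2; exists B.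
have /subseqP[m sm EB0] := sB0.
have fB0 : free B0 by rewrite -(perm_free pB).
pose m' := Tuple (introT eqP sm).
have := hk m'; rewrite /= -EB0 => /(_ fB0 _ cT) hkB.
have PB : \prod_(b <- B0) w b = \prod_(b <- B) w b by apply: perm_big; rewrite perm_sym.
rewrite mulrAC ler_pdivrMr ?exprn_gt0 // -exprMn.
apply: le_trans (_ : (\prod_(b <- B) w b) ^+ s <= _).
  apply: lerXn2r; rewrite ?nnegrE -?PB //.
  + exact: mulr_ge0 (ltW k0) (sqr_ge0 _).
  + by apply: prodr_ge0 => b _; apply: dot_ge0.
rewrite -prodrXl; apply: le_trans hB _; rewrite (perm_big _ pl) /=.
apply: ler_wpM2l; first by apply: prodr_ge0 => b _; apply: dot_ge0.
apply: ler_weXn2l => //; apply: leq_trans (leq_subr _ _) _.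
rewrite leq_mul2l; apply/orP; right.
exact: dim_le_ambient.
Qed.

(** * Rank-one perturbations and nearly isotropic position *)

(** Eliminating either diagonal block of [A] gives two block triangular factorizations, whose
    determinants are the two sides. *)
Lemma det_1_add_rank1 (R : realType) (d : nat) (u v : 'rV[R]_d) :
  \det (1%:M + u^T *m v) = 1 + dot u v.
Proof.
pose A : 'M[R]_(1 + d) := block_mx 1%:M (- v) u^T 1%:M.
have E1 : A = block_mx 1%:M 0 u^T 1%:M *m block_mx 1%:M (- v) 0 (1%:M + u^T *m v).
  rewrite mulmx_block !mulmx0 !mul0mx !mul1mx !mulmx1 !addr0 mulmxN.
  by rewrite addrCA addNr addr0.
have E2 : A = block_mx 1%:M (- v) 0 1%:M *m block_mx (1%:M + v *m u^T) 0 u^T 1%:M.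
  rewrite mulmx_block !mulmx0 !mul0mx !mul1mx !mulmx1 !add0r mulNmx.
  by rewrite addrK.
have := congr1 determinant E1; rewrite E2 !det_mulmx !det_lblock !det_ublock.
rewrite !det1 !mulr1 !mul1r => <-.
by rewrite det_mx11 mxE [X in X + _]mxE eqxx dotC.
Qed.

(* Halves the component along [z] and fixes its orthogonal complement; its
   determinant is 1/2 only for [z != 0]. *)
Definition halving (R : realType) (d : nat) (z : 'rV[R]_d) : 'M[R]_d :=
  1%:M + z^T *m ((- (2 * dot z z)^-1) *: z).

Lemma det_halving (R : realType) (d : nat) (z : 'rV[R]_d) :
  z != 0 -> \det (halving z) = 2^-1.
Proof.
rewrite -dot_gt0 /halving det_1_add_rank1 dotZr => z0.
by field; rewrite lt0r_neq0.
Qed.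

(** Halving the component along [z] removes three quarters of its squared length
    [dot u z ^+ 2 / dot z z]. *)
Lemma dot_halving (R : realType) (d : nat) (z u : 'rV[R]_d) : z != 0 ->
  dot (u *m halving z) (u *m halving z) =
  dot u u - 3 / 4 * (dot u z ^+ 2 / dot z z).
Proof.
rewrite -dot_gt0 => z0.
have -> : u *m halving z = u + (- (dot u z / (2 * dot z z))) *: z.
  rewrite mulmxDr mulmx1 mulmxA [u *m z^T]mx11_scalar mul_scalar_mx.
  by rewrite scalerA mulrN -/(dot u z).
rewrite !(dotDl, dotDr, dotZl, dotZr) (dotC z u).
by field; rewrite lt0r_neq0.
Qed.

(* [T] minimises prod |z T|^2 / det(T)^(2s) over contractions up to a factor 2;
   comparing with [T *m halving e] bounds the sum over u of cos2 u e. *)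
Lemma near_isotropic (R : realType) (d s : nat) (l : seq 'rV[R]_d) : (0 < s)%N ->
  (forall U : {vspace 'rV[R]_d}, (count (fun z => z \in U) l <= s * \dim U)%N) ->
  exists2 T : 'M[R]_d, T \in unitmx & forall z, z \in l ->
    \sum_(u <- l) cos2 (u *m T) (z *m T) <= 4 * s%:R.
Proof.
move=> s0 cnt; have [k k0 hk] := prod_lower_bound cnt.
have l0 := density_neq0 cnt.
pose contr (T : 'M[R]_d) := forall z, dot (z *m T) (z *m T) <= dot z z.
pose G (T : 'M[R]_d) := (\prod_(z <- l) dot (z *m T) (z *m T)) / (\det T ^+ 2) ^+ s.
pose A : classical_sets.set R := fun g => exists T, [/\ T \in unitmx, contr T & g = G T].
have det0 (T : 'M[R]_d) : T \in unitmx -> 0 < (\det T ^+ 2) ^+ s.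
  by rewrite unitmxE unitfE => h; rewrite exprn_gt0 // exprn_even_gt0.
have lbk : classical_sets.lbound A k.
  by move=> _ [T [Tu cT ->]]; rewrite /G ler_pdivlMr ?det0 // hk.
have A0 : classical_sets.nonempty A.
  by exists (G 1%:M), 1%:M; split => // [|z]; rewrite ?unitmx1 ?mulmx1.
have infk : k <= inf A by apply: lb_le_inf.
have hinf : classical_sets.has_inf A by split => //; exists k.
(* As [inf A >= k > 0], the infimum itself is an admissible tolerance, giving [G T < 2 * inf A]. *)
have [_ [T [Tu cT ->]] ltG] := inf_adherent (lt_le_trans k0 infk) hinf.
exists T => // z zl.
have nz y : y \in l -> 0 < dot (y *m T) (y *m T).
  move=> /l0 y0; rewrite dot_gt0.
  by apply: contra y0 => /eqP h; rewrite -(mulmxK Tu y) h mul0mx.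
pose e := z *m T; have e0 : e != 0 by rewrite -dot_gt0 nz.
pose a u := cos2 (u *m T) e.
pose T' := T *m halving e.
have dT' : \det T' = \det T / 2 by rewrite det_mulmx det_halving.
have T'u : T' \in unitmx.
  by rewrite unitmxE dT' unitrM -unitmxE Tu unitfE invr_eq0 pnatr_eq0.
have cT' : contr T'.
  move=> u; rewrite /T' mulmxA dot_halving //; apply: le_trans (cT u).
  by rewrite gerBl mulr_ge0 // divr_ge0 ?sqr_ge0 ?dot_ge0.
(* Every squared length shrinks by [1 - 3 / 4 * a u], while halving the determinant gains
   [4 ^+ s]. *)
have GT' : G T' = G T * (\prod_(u <- l) (1 - 3 / 4 * a u) * 4 ^+ s).
  rewrite /G; have -> : \prod_(y <- l) dot (y *m T') (y *m T') =
    \prod_(y <- l) dot (y *m T) (y *m T) * \prod_(u <- l) (1 - 3 / 4 * a u).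
    rewrite -big_split /=; apply: eq_big_seq => y /nz y0.
    rewrite /T' mulmxA dot_halving // /a /cos2.
    have e0' : 0 < dot e e by rewrite dot_gt0.
    by field; rewrite (lt0r_neq0 y0) (lt0r_neq0 e0').
  have -> : (\det T' ^+ 2) ^+ s = (\det T ^+ 2) ^+ s / 4 ^+ s.
    by rewrite dT' !expr_div_n (_ : 2 ^+ 2 = 4 :> R) //; ring.
  by rewrite invfM invrK mulrACA !mulrA.
have G0 : 0 < G T.
  by rewrite divr_gt0 ?det0 // big_seq; apply: prodr_gt0.
have infT' : inf A <= G T'.
  by apply: ge_inf; [exists k | exists T'].
pose S := \sum_(u <- l) a u.
have prod_exp : \prod_(u <- l) (1 - 3 / 4 * a u) <= sequences.expR (- (3 / 4 * S)).
  have -> : - (3 / 4 * S) = \sum_(u <- l) - (3 / 4 * a u) by rewrite sumrN mulr_sumr.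
  rewrite exp.expR_sum.
  rewrite big_seq [leRHS]big_seq; apply: ler_prod => u ul.
  rewrite exp.expR_ge1Dx andbT.
  have : a u <= 1.
    rewrite /a /cos2 ler_pdivrMr ?mul1r ?Cauchy_Schwarz_dot //.
    by apply: mulr_gt0; rewrite ?dot_gt0 //; rewrite -dot_gt0 nz.
  by lra.
have e2 : 2 <= sequences.expR (1 : R) by have := exp.expR_ge1Dx (1 : R); lra.
(* From [G T < 2 * G T'] and [1 - x <= exp (- x)] follows [exp (3 / 4 * S) < 2 * 4 ^+ s]. For
   [s >= 1] this is at most [8 ^+ s], and [8 <= exp 3]; hence [S < 4 * s]. *)
have hS : sequences.expR (3 / 4 * S) < sequences.expR (3 * s%:R).
  apply: lt_le_trans (_ : 2 * 4 ^+ s <= _).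
    have h : G T < G T * (2 * (sequences.expR (- (3 / 4 * S)) * 4 ^+ s)).
      apply: lt_le_trans ltG _; apply: le_trans (lerD infT' infT') _.
      rewrite -mulr2n GT' -[leLHS]mulr_natl mulrCA.
      apply: ler_wpM2l; first exact: ltW.
      apply: ler_wpM2l => //; apply: ler_wpM2r => //; exact: exprn_ge0.
    move: h; rewrite -{1}[G T]mulr1 ltr_pM2l // exp.expRN mulrCA mulrC.
    by rewrite ltr_pdivlMr ?mul1r // exp.expR_gt0.
  have e8 : 8 <= sequences.expR (3 : R).
    rewrite -[3]mulr1 exp.expRM_natl (_ : 8 = 2 ^+ 3); last by ring.
    by apply: lerXn2r; rewrite ?nnegrE // exp.expR_ge0.
  rewrite exp.expRM_natr; apply: le_trans (_ : 8 ^+ s <= _); last first.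
    by apply: lerXn2r; rewrite ?nnegrE // exp.expR_ge0.
  rewrite (_ : 8 = 2 * 4 :> R); last by ring.
  rewrite exprMn ler_wpM2r ?exprn_ge0 // -(prednK s0) exprS.
  by rewrite ler_peMr // exprn_ege1 // ler1n.
by move: hS; rewrite exp.ltr_expR -/S; lra.
Qed.

(** * Squared cosines in a plane *)

(** For the normalized vectors y, the double sum is the squared Frobenius norm of the sum of the
    matrices y^T y. In an orthogonal frame [p], [g] the sums of [a] and [b] are its diagonal
    entries; they add up to its trace [size L], so their squares add up to at least half the square
    of the trace. *)
Lemma planar_cos2_sum (R : realType) (d : nat) (I : eqType) (L : seq I)
    (z : I -> 'rV[R]_d) (p q : 'rV[R]_d) :
  (forall i, i \in L -> z i != 0) ->
  (forall i, i \in L -> z i \in (<[p]> + <[q]>)%VS) ->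
  (size L)%:R ^+ 2 / 2 <= \sum_(i <- L) \sum_(j <- L) cos2 (z i) (z j).
Proof.
move=> z0 zpq.
(* Gram-Schmidt; if [p = 0], division by 0 gives 0 and [g = q]. *)
pose g := q + (- (dot q p / dot p p)) *: p.
have gp : dot g p = 0.
  rewrite /g dotDl dotZl; have [->|p0] := eqVneq p 0.
    by rewrite (dotC q) /dot !mul0mx !mxE mulr0 addr0.
  by rewrite mulNr divfK ?subrr // lt0r_neq0 // dot_gt0.
have /boolp.choice [c hc] i : exists c : R * R, i \in L -> z i = c.1 *: p + c.2 *: g.
  have [iL|iL] := boolP (i \in L); last by exists (0, 0).
  have /memv_addP[u /vlineP[a ->] [v /vlineP[b ->] ->]] := zpq i iL.
  exists (a + b * (dot q p / dot p p), b) => _ /=.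
  by rewrite /g scalerDr scalerA addrCA -scalerDl mulrN addrK addrC.
clearbody g.
pose F := dot p p; pose G := dot g g.
pose n i := dot (z i) (z i).
have nE i : i \in L -> n i = (c i).1 ^+ 2 * F + (c i).2 ^+ 2 * G.
  move=> iL; rewrite /n (hc i iL) !(dotDl, dotDr, dotZl, dotZr) (dotC p g) gp /F /G.
  by ring.
have n0 i : i \in L -> n i != 0.
  by move=> /z0 zi; rewrite lt0r_neq0 // dot_gt0.
pose a i := (c i).1 ^+ 2 * F / n i; pose b i := (c i).2 ^+ 2 * G / n i.
pose m i := (c i).1 * (c i).2 / n i.
have ab i : i \in L -> a i + b i = 1.
  by move=> iL; rewrite /a /b -mulrDl -nE // divff // n0.
have cE i j : i \in L -> j \in L ->
    cos2 (z i) (z j) = a i * a j + b i * b j + 2 * F * G * (m i * m j).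
  move=> iL jL; rewrite /cos2 -/(n i) -/(n j) {1}(hc i iL) {1}(hc j jL).
  rewrite !(dotDl, dotDr, dotZl, dotZr) (dotC p g) gp /a /b /m -/F -/G.
  by field; rewrite !n0.
have sumsq (h : I -> R) : \sum_(i <- L) \sum_(j <- L) h i * h j = (\sum_(i <- L) h i) ^+ 2.
  by rewrite expr2 mulr_suml; apply: eq_bigr => i _; rewrite mulr_sumr.
have -> : \sum_(i <- L) \sum_(j <- L) cos2 (z i) (z j) =
   (\sum_(i <- L) a i) ^+ 2 + (\sum_(i <- L) b i) ^+ 2
   + 2 * F * G * (\sum_(i <- L) m i) ^+ 2.
  rewrite -!sumsq mulr_sumr -!big_split /=; apply: eq_big_seq => i iL.
  rewrite mulr_sumr -!big_split /=; apply: eq_big_seq => j jL.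
  exact: cE.
have -> : (size L)%:R = \sum_(i <- L) a i + \sum_(i <- L) b i.
  rewrite -big_split /= -sum1_size natr_sum; apply: eq_big_seq => i iL.
  by rewrite ab.
have FG : 0 <= 2 * F * G * (\sum_(i <- L) m i) ^+ 2.
  apply: mulr_ge0 (sqr_ge0 _); apply: mulr_ge0 (dot_ge0 _).
  by apply: mulr_ge0 (dot_ge0 _).
have := sqr_ge0 (\sum_(i <- L) a i - \sum_(i <- L) b i).
by move: FG; set A := \sum_(i <- L) a i; set B := \sum_(i <- L) b i; nra.
Qed.

Lemma line_add_dim2 (R : realType) (d : nat) (P : {vspace 'rV[R]_d}) (u v : 'rV[R]_d) :
  \dim P = 2%N -> u \in P -> v \in P -> (1 < \dim (<[u]> + <[v]>))%N ->
  P = (<[u]> + <[v]>)%VS.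
Proof.
move=> dP uP vP duv; apply/esym/eqP; rewrite eqEdim dP duv andbT.
by rewrite subv_add -!memvE uP.
Qed.

Lemma dim_line_add (R : realType) (d : nat) (u v : 'rV[R]_d) :
  u != 0 -> v \notin <[u]>%VS -> (1 < \dim (<[u]> + <[v]>))%N.
Proof.
move=> u0 vu; have du : \dim <[u]> = 1%N by rewrite dim_vline u0.
rewrite -{1}du ltn_neqAle (dimv_leqif_sup (addvSl _ _)).1 andbT.
rewrite (dimv_leqif_sup (addvSl _ _)).2; apply: contra vu => /subvP h.
by apply: h; apply: (subvP (addvSr _ _)); apply: memv_line.
Qed.

(** Let k be the size of [S]. If [f] is injective on [P], removing the k diagonal terms from
    [planar_cos2_sum] leaves k^2/2 - k, which is at least 3/4 (k - 1) for k >= 3, with equality at k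
    = 3. Otherwise [f] maps [P] onto a line, and all cosines between nonzero images are 1. *)
Lemma plane_cos2_sum (R : realType) (d : nat) (f : 'End('rV[R]_d))
    (P : {vspace 'rV[R]_d}) (S : seq 'rV[R]_d) :
  uniq S -> \dim P = 2%N -> (forall v, v \in S -> v \in P) ->
  (forall u v, u \in S -> v \in S -> u != v -> (1 < \dim (<[u]> + <[v]>))%N) ->
  (2 < size S)%N -> (exists2 u, u \in S & f u != 0) ->
  3 / 4 * ((size S)%:R - 1) <= \sum_(u <- S) \sum_(v <- S | v != u) cos2 (f u) (f v).
Proof.
move=> uS dP SP indep S3 [u0 u0S fu0].
have [PK|PK] := eqVneq (P :&: lker f)%VS 0%VS.
  (* A point of [S] killed by [f] would be 0, hence not independent of [u0]. *)
  have fn0 v : v \in S -> f v != 0.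
    move=> vS; apply/eqP => fv0.
    have : v \in (P :&: lker f)%VS by rewrite memv_cap SP //= memv_ker fv0.
    rewrite PK memv0 => /eqP v0.
    have u0v : u0 != v by apply: contra fu0 => /eqP ->; rewrite fv0.
    have := indep _ _ u0S vS u0v; rewrite v0 ltnNge.
    have -> // : (\dim (<[u0]> + <[0%R]>) <= 1)%N.
    by rewrite addv0 dim_vline leq_b1.
  have [v0 v0S] : exists2 v, v \in S & predC (pred1 u0) v.
    apply/hasP; rewrite has_count; move: S3; rewrite -(count_predC (pred1 u0) S).
    by rewrite count_uniq_mem // u0S; case: (count _ _).
  rewrite /= eq_sym => v0u0.
  have PE := line_add_dim2 dP (SP _ u0S) (SP _ v0S) (indep _ _ u0S v0S v0u0).
  have fP v : v \in S -> f v \in (<[f u0]> + <[f v0]>)%VS.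
    by move=> /SP; rewrite {1}PE -!limg_line -limgD => /(memv_img f).
  have := planar_cos2_sum fn0 fP.
  have -> : \sum_(u <- S) \sum_(v <- S) cos2 (f u) (f v) =
      (size S)%:R + \sum_(u <- S) \sum_(v <- S | v != u) cos2 (f u) (f v).
    rewrite -sum1_size natr_sum -big_split /=; apply: eq_big_seq => u uS'.
    by rewrite (bigD1_seq u) //= cos2_diag ?fn0.
  move: S3; rewrite -(ler_nat R); set k : R := (size S)%:R; set X := \sum_(u <- S) _.
  by nra.
have [w wPK w0] : exists2 w, w \in (P :&: lker f)%VS & w != 0.
  by exists (vpick (P :&: lker f)); rewrite ?memv_pick ?vpick0.
move: wPK; rewrite memv_cap memv_ker => /andP[wP /eqP fw].
have fline v : v \in P -> exists a b, v = a *: w + b *: u0.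
  rewrite {1}(line_add_dim2 dP wP (SP _ u0S)); last first.
    apply: dim_line_add => //; apply: contra fu0 => /vlineP[a ->].
    by rewrite linearZ /= fw scaler0.
  move=> /memv_addP[_ /vlineP[a ->] [_ /vlineP[b ->] ->]].
  by exists a, b.
pose L := [seq v <- S | f v != 0].
(* The points of [S] killed by [f] lie on the line of [w], which contains at most one of them by
   independence. *)
have szL : (size S <= (size L).+1)%N.
  suff : (count (predC (fun v : 'rV[R]_d => f v != 0%R)) S <= 1)%N.
    rewrite -[size S](count_predC (fun v : 'rV[R]_d => f v != 0%R)) size_filter.
    by move=> h; rewrite -[leqRHS]addn1; apply: leq_add.
  rewrite -size_filter.
  have uK := filter_uniq (predC (fun v : 'rV[R]_d => f v != 0%R)) uS.
  have hK v : v \in [seq v <- S | predC (fun v : 'rV[R]_d => f v != 0%R) v] -> v \in S /\ v \in <[w]>%VS.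
    rewrite mem_filter /= negbK => /andP[/eqP fv vS]; split => //.
    have [a [b vE]] := fline v (SP v vS).
    move: fv; rewrite vE linearD !linearZ /= fw scaler0 add0r => /eqP.
    by rewrite scaler_eq0 (negPf fu0) orbF => /eqP ->; rewrite scale0r addr0 memvZ ?memv_line.
  move: uK hK; case: [seq v <- S | _] => [//|x [//|y t]] uK hK.
  have [xS xw] := hK x (mem_head _ _).
  have [|yS yw] := hK y; first by rewrite !inE eqxx orbT.
  have xy : x != y by move: uK; rewrite /= inE negb_or => /andP[/andP[]].
  have := indep _ _ xS yS xy; rewrite ltnNge.
  have -> // : (\dim (<[x]> + <[y]>) <= 1)%N.
  apply: leq_trans (_ : \dim <[w]> <= _)%N; last by rewrite dim_vline w0.
  by apply: dimvS; rewrite subv_add -!memvE xw.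
have lb : \sum_(u <- L) \sum_(v <- L | v != u) 1 <=
     \sum_(u <- S) \sum_(v <- S | v != u) cos2 (f u) (f v).
  rewrite big_filter big_mkcond big_seq [leRHS]big_seq /=; apply: ler_sum => u uS'.
  have [fu|fu] := ifP; last by apply: sumr_ge0 => v _; apply: cos2_ge0.
  rewrite big_filter_cond big_mkcond [leRHS]big_mkcond big_seq [leRHS]big_seq /=.
  apply: ler_sum => v vS; have [vu|vu] := eqVneq v u; rewrite ?andbF ?andbT //=.
  have [fv|fv] := ifP; last exact: cos2_ge0.
  rewrite (cos2_parallel (p := f u0)) //.
    have [a [b ->]] := fline u (SP u uS').
    by rewrite linearD !linearZ /= fw scaler0 add0r memvZ ?memv_line.
  have [a [b ->]] := fline v (SP v vS).
  by rewrite linearD !linearZ /= fw scaler0 add0r memvZ ?memv_line.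
apply: le_trans lb.
have -> : \sum_(u <- L) \sum_(v <- L | v != u) (1 : R) = (size L)%:R * ((size L)%:R - 1).
  have sz1 : \sum_(u <- L) (1 : R) = (size L)%:R by rewrite -sum1_size natr_sum.
  rewrite -{1}sz1 mulr_suml; apply: eq_big_seq => u uL.
  by rewrite -sz1 (bigD1_seq u) ?filter_uniq //= mul1r addrAC subrr add0r.
(* With m >= k - 1 and k >= 3, m (m - 1) >= (k - 1) (k - 2) >= k - 1. *)
move: S3 szL; rewrite -!(ler_nat R) -[(size L).+1]addn1 natrD.
by set k : R := (size S)%:R; set m : R := (size L)%:R; nra.
Qed.

(** * Summation over the planes of the triples *)

Lemma ler_sum_mem (R : numDomainType) (I : eqType) (r : seq I) (F G : I -> R) :
  (forall i, i \in r -> F i <= G i) -> \sum_(i <- r) F i <= \sum_(i <- r) G i.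
Proof. by move=> h; rewrite big_seq [leRHS]big_seq; apply: ler_sum. Qed.

Lemma size_filter_fset (K : choiceType) (A : {fset K}) (p : pred K) :
  #|` [fset x in A | p x]%fset| = size [seq x <- A | p x].
Proof.
apply: perm_size; apply: uniq_perm; rewrite ?fset_uniq ?filter_uniq //.
by move=> x; rewrite mem_filter !inE andbC.
Qed.

(** Two distinct points of [V] span a plane, the only one in [Ps] that can contain both, so each
    ordered pair is counted at most once on the left. *)
Lemma sum_planes_le (R : realType) (d : nat) (V : seq 'rV[R]_d)
    (Ps : seq {vspace 'rV[R]_d}) (c : 'rV[R]_d -> 'rV[R]_d -> R) :
  uniq Ps -> (forall P, P \in Ps -> \dim P = 2%N) ->
  (forall u v, u \in V -> v \in V -> u != v -> (1 < \dim (<[u]> + <[v]>))%N) ->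
  (forall u v, 0 <= c u v) ->
  \sum_(P <- Ps) \sum_(u <- [seq u <- V | u \in P])
     \sum_(v <- [seq u <- V | u \in P] | v != u) c u v <=
  \sum_(u <- V) \sum_(v <- V | v != u) c u v.
Proof.
move=> uPs dPs indep c0.
pose t (P : {vspace 'rV[R]_d}) u v := if (u \in P) && ((v \in P) && (v != u)) then c u v else 0.
have -> : \sum_(P <- Ps) \sum_(u <- [seq u <- V | u \in P])
     \sum_(v <- [seq u <- V | u \in P] | v != u) c u v =
   \sum_(u <- V) \sum_(v <- V) \sum_(P <- Ps) t P u v.
  under [RHS]eq_bigr => u _ do rewrite exchange_big.
  rewrite [RHS]exchange_big; apply: eq_bigr => P _ /=.
  rewrite big_filter big_mkcond; apply: eq_bigr => u _.
  rewrite big_filter_cond big_mkcond; case: ifP => uP; last first.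
    by rewrite big1 // => v _; rewrite /t uP.
  by apply: eq_bigr => v _; rewrite /t uP.
apply: ler_sum_mem => u uV; rewrite [leRHS]big_mkcond; apply: ler_sum_mem => v vV.
have [vu|vu] := eqVneq v u.
  by rewrite big1 // => P _; rewrite /t vu eqxx !andbF.
apply: le_trans (_ : \sum_(P <- Ps | P == (<[u]> + <[v]>)%VS) c u v <= _).
  rewrite [leRHS]big_mkcond; apply: ler_sum_mem => P PPs; rewrite /t.
  have [/andP[uP /andP[vP _]]|_] := ifP; last by case: ifP.
  have -> // : P == (<[u]> + <[v]>)%VS.
  apply/eqP; apply: line_add_dim2 => //; first exact: dPs.
  by apply: indep => //; rewrite eq_sym.
set Q := (_ + _)%VS; have [QP|QP] := boolP (Q \in Ps).
  rewrite big_mkcond (bigD1_seq Q) //= eqxx big1 ?addr0 //.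
  by move=> P /negPf ->.
by rewrite big1_seq // => P /andP[/eqP ->]; rewrite (negPf QP).
Qed.

(** Group the triples by the plane they span. A plane with k points of [V] carries at most k - 1
    triples by hypothesis, and [plane_cos2_sum] pays 3/4 for each of them. *)
Lemma triples_cos2_sum (R : realType) (d : nat) (V : {fset 'rV[R]_d})
    (E : seq {fset 'rV[R]_d}) (f : 'End('rV[R]_d)) :
  (forall u v, u \in V -> v \in V -> u != v -> (1 < \dim (<[u]> + <[v]>))%N) ->
  (forall e, e \in E -> [/\ #|` e| = 3%N, (e `<=` V)%fset, (spandim e <= 2)%N
     & exists2 u, u \in e & f u != 0]) ->
  (forall V' : {fset 'rV[R]_d}, (V' `<=` V)%fset -> (spandim V' <= 2)%N ->
     (ntriples_in E V' <= #|` V'| - 1)%N) ->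
  3 / 4 * (size E)%:R <= \sum_(u <- V) \sum_(v <- V | v != u) cos2 (f u) (f v).
Proof.
move=> indep hE hcap.
pose sp (e : {fset 'rV[R]_d}) : {vspace 'rV[R]_d} := <<(e : seq 'rV[R]_d)>>%VS.
pose Ps := undup (map sp E).
have dsp e : e \in E -> \dim (sp e) = 2%N.
  move=> /hE[e3 eV de _]; apply/eqP; rewrite eqn_leq de /=.
  have ue : uniq e by apply: fset_uniq.
  have : {subset (e : seq _) <= sp e} by move=> x xe; apply: memv_span.
  have eV' : {subset (e : seq _) <= V} by apply/fsubsetP.
  move: e3 ue eV'; case: (e : seq _) => [//|x [//|y r]] _ ue eV' esp.
  have xy : x != y by move: ue; rewrite /= inE negb_or => /andP[/andP[]].
  apply: leq_trans (indep x y _ _ xy) _; rewrite ?eV' ?inE ?eqxx ?orbT //.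
  by apply: dimvS; rewrite subv_add -!memvE !esp ?inE ?eqxx ?orbT.
have dP P : P \in Ps -> \dim P = 2%N.
  by rewrite mem_undup => /mapP[e eE ->]; apply: dsp.
apply: le_trans (sum_planes_le (undup_uniq _) dP indep (fun u v => cos2_ge0 (f u) (f v))).
have -> : (size E)%:R = \sum_(P <- Ps) (count (fun e => sp e == P) E)%:R :> R.
  rewrite -natr_sum; congr (_%:R).
  under eq_bigr => P _ do rewrite -sum1_count big_mkcond.
  rewrite exchange_big /= -sum1_size; apply: eq_big_seq => e eE.
  have ePs : sp e \in Ps by rewrite mem_undup map_f.
  rewrite (bigD1_seq (sp e)) ?undup_uniq //= eqxx big1 ?addn0 // => P.
  by rewrite eq_sym => /negPf ->.
rewrite mulr_sumr; apply: ler_sum_mem => P PPs.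
set S := [seq u <- V | u \in P].
have : P \in map sp E by rewrite -mem_undup.
case/mapP => e eE PE.
have [e3 eV de [u ue fu]] := hE e eE.
have eS : {subset (e : seq _) <= S}.
  by move=> x xe; rewrite mem_filter (fsubsetP eV) // PE memv_span.
pose VP := [fset x in V | x \in P]%fset.
have sVP : #|` VP| = size S by rewrite size_filter_fset.
have hVP : (ntriples_in E VP <= size S - 1)%N.
  rewrite -sVP; apply: hcap; first by apply/fsubsetP => x; rewrite !inE => /andP[].
  rewrite /spandim -(dP P PPs); apply: dimvS; apply/span_subvP => x.
  by rewrite !inE => /andP[].
have cS : (count (fun e => sp e == P) E <= size S - 1)%N.
  apply: leq_trans hVP; rewrite /ntriples_in.
  rewrite (eq_in_count (a2 := fun g => (g \in E) && (sp g == P))); last by move=> g ->.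
  apply: sub_count => g /= /andP[gE /eqP gP]; apply/fsubsetP => x xg.
  by have [_ gV _ _] := hE g gE; rewrite !inE (fsubsetP gV) //= -gP memv_span.
have S3 : (2 < size S)%N by rewrite -e3; apply: uniq_leq_size; [exact: fset_uniq | exact: eS].
apply: le_trans (plane_cos2_sum _ (dP P PPs) _ _ S3 _).
- apply: ler_wpM2l; first by lra.
  rewrite lerBrDr (_ : _ + 1 = (count (fun g => sp g == P) E).+1%:R) ?natr1 // ler_nat.
  by apply: (leq_ltn_trans cS); rewrite subn1 ltn_predL (ltn_trans _ S3).
- exact/filter_uniq/fset_uniq.
- by move=> v; rewrite mem_filter => /andP[].
- by move=> x y; rewrite !mem_filter => /andP[_ xV] /andP[_ yV]; apply: indep.
- by exists u => //; apply: eS.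
Qed.

(** * Subspaces of maximal density and quotients *)

(* The inequality says that |V \cap U| - s dim U is maximal at U = W; negative
   terms are moved across to avoid truncated subtraction. *)
Lemma max_density_subspace (R : realType) (d s : nat) (V : seq 'rV[R]_d) :
  exists W : {vspace 'rV[R]_d}, forall U : {vspace 'rV[R]_d},
    (count (fun v => v \in U) V + s * \dim W <=
     count (fun v => v \in W) V + s * \dim U)%N.
Proof.
(* Adding the constant [s * d] gives a natural number bounded by [size V + s * d], so a maximum
   exists. *)
pose val (U : {vspace 'rV[R]_d}) := (count (fun v => v \in U) V + s * (d - \dim U))%N.
have exv : exists m, `[< exists U, val U = m >] by exists (val 0%VS); apply/asboolP; exists 0%VS.
have bnd m : `[< exists U, val U = m >] -> (m <= size V + s * d)%N.
  move=> /asboolP[U <-]; apply: leq_add; first exact: count_size.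
  by rewrite leq_mul2l leq_subr orbT.
case: (ex_maxnP exv bnd) => m /asboolP[W <-] hmax; exists W => U.
have : (val U <= val W)%N by apply: hmax; apply/asboolP; exists U.
have := dim_le_ambient U; have := dim_le_ambient W; rewrite /val !mulnBr.
move=> hW hU; have : (s * \dim W <= s * d)%N by rewrite leq_mul2l hW orbT.
have : (s * \dim U <= s * d)%N by rewrite leq_mul2l hU orbT.
move: (count _ V) (count _ V) (s * \dim W)%N (s * \dim U)%N (s * d)%N; lia.
Qed.

(** Compare [W] with the preimage of [U]: it contains [W], has dimension at most [\dim W + \dim U],
    and its points in [V] are those of [W] and those outside [W] that [f] sends into [U]. *)
Lemma quotient_count (R : realType) (d s : nat) (V : seq 'rV[R]_d)
    (W U : {vspace 'rV[R]_d}) (f : 'End('rV[R]_d)) :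
  (forall U : {vspace 'rV[R]_d},
    (count (fun v => v \in U) V + s * \dim W <=
     count (fun v => v \in W) V + s * \dim U)%N) ->
  lker f = W ->
  (count (fun z => z \in U) [seq f v | v <- V & v \notin W] <= s * \dim U)%N.
Proof.
move=> hmax fW; pose U' := (f @^-1: U)%VS.
have WU' : (W <= U')%VS.
  apply/subvP => x; rewrite -fW memv_ker -memv_preim => /eqP ->; exact: mem0v.
have dU' : (\dim U' <= \dim W + \dim U)%N.
  rewrite -(limg_ker_dim f U') fW (capv_idPr WU') leq_add2l.
  apply: dimvS; apply/subvP => _ /memv_imgP[x xU' ->].
  by rewrite memv_preim.
have : (count (fun z => z \in U) [seq f v | v <- V & v \notin W] +
   count (fun v => v \in W) V <= count (fun v => v \in U') V)%N.
  rewrite count_map count_filter.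
  have -> : count (fun v => v \in U') V =
    (count [predI (preim f (fun z => z \in U)) & (fun v => v \notin W)] V +
     count (fun v => v \in W) V)%N.
    rewrite -count_predUI [X in (_ + X)%N](eq_count (a2 := pred0)).
      rewrite count_pred0 addn0; apply: eq_count => v /=.
      rewrite -memv_preim.
      change ((f v \in U) = (f v \in U) && (v \notin W) || (v \in W)).
      have [vW|vW] := boolP (v \in W); rewrite ?andbT ?orbF //.
      by rewrite orbT memv_preim (subvP WU').
    move=> v; change ((f v \in U) && (v \notin W) && (v \in W) = false).
    by case: (v \in W); rewrite ?andbF.
  by [].
have := hmax U'; have : (s * \dim U' <= s * \dim W + s * \dim U)%N.
  by rewrite -mulnDr leq_mul2l dU' orbT.
move: (count _ _) (count _ V) (count _ V) (s * \dim W)%N (s * \dim U)%N (s * \dim U')%N.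
lia.
Qed.

(** * Bounding the triples outside the subspace *)

Unset Implicit Arguments.
Local Open Scope fset_scope.

Theorem mainTheorem16 (R : realType) (d : nat)
  (V : {fset 'rV[R]_d}) (E : seq {fset 'rV[R]_d}) :
  V != fset0 ->
  0 \notin V ->
  (forall u v, u \in V -> v \in V -> u != v -> spandim [fset u; v] = 2%N) ->
  (forall e, e \in E -> [/\ #|` e| = 3%N, e `<=` V & (spandim e <= 2)%N]) ->
  (forall V', V' `<=` V -> (spandim V' <= 2)%N ->
     (ntriples_in E V' <= #|` V'| - 1)%N) ->
  forall lambda : R, 0 < lambda ->
  exists V', [/\ V' `<=` V,
     ((size E - ntriples_in E V')%:R < lambda * (#|` V|)%:R) &
     ((spandim V')%:R <= 12 * (#|` V|)%:R / lambda)].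
Proof.
move=> V0 _ indep hE hcap lam lam0.
have n0 : 0 < (#|` V|)%:R :> R by rewrite ltr0n cardfs_gt0.
have [lam12|lam12] := leP lam 12.
  exists V; split => //.
    have -> : ntriples_in E V = size E.
      by apply/eqP; rewrite -all_count; apply/allP => e /hE[].
    by rewrite subnn mulr_gt0.
  rewrite ler_pdivlMr //; apply: le_trans (_ : (#|` V|)%:R * lam <= _).
    by rewrite ler_pM2r // ler_nat; apply: dim_span.
  by rewrite mulrC ler_pM2r.
have indep' u v : u \in V -> v \in V -> u != v -> (1 < \dim (<[u]> + <[v]>))%N.
  move=> uV vV uv; rewrite -(indep u v uV vV uv); apply: dimvS.
  apply/span_subvP => x; rewrite !inE => /orP[] /eqP ->.
    by apply: (subvP (addvSl _ _)); apply: memv_line.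
  by apply: (subvP (addvSr _ _)); apply: memv_line.
(* [s > lam / 12] bounds the dimension of [W]; [s <= lam / 12 + 1 < lam / 6], as [lam > 12], bounds
   the number of lost triples. *)
pose s := (Num.truncn (lam / 12)).+1.
have l12 : 0 <= lam / 12 by rewrite divr_ge0 // ltW.
have /andP[s1 s2] := truncn_itv l12.
have {}s1 : s%:R <= (lam / 12 + 1)%R by rewrite /s -natr1 lerD2r.
have [W hW] := max_density_subspace s V.
(* A projection with kernel [W] realizes the quotient by [W] inside the same space. *)
pose p : 'End('rV[R]_d) := (\1 - projv W)%VF.
have pE v : p v = v - projv W v by rewrite /p !lfun_simp.
have kp : lker p = W.
  apply/vspaceP => v; rewrite memv_ker pE subr_eq0.
  apply/eqP/idP => [->|vW]; first exact: memv_proj.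
  by rewrite projv_id.
have [T Tu hT] := @near_isotropic R d s _ isT (fun U => quotient_count U hW kp).
pose f : 'End('rV[R]_d) := (linfun (mulmxr T) \o p)%VF.
have fE v : f v = p v *m T by rewrite /f comp_lfunE lfunE.
have f0 v : (f v == 0) = (v \in W).
  rewrite -kp memv_ker fE; apply/eqP/eqP => [h|->]; last by rewrite mul0mx.
  by rewrite -(mulmxK Tu (p v)) h mul0mx.
pose V' := [fset v in V | v \in W].
have V'V : V' `<=` V by apply/fsubsetP => x; rewrite !inE => /andP[].
exists V'; split => //; last first.
  have dV' : (spandim V' <= \dim W)%N.
    by apply: dimvS; apply/span_subvP => x; rewrite !inE => /andP[].
  (* Maximality of [W] compared with the zero subspace. *)
  have sW : (s * \dim W <= #|` V|)%N.
    have := hW 0%VS; rewrite dimv0 muln0 addn0 => h.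
    apply: leq_trans (leq_trans (leq_addl _ _) h) _; exact: count_size.
  rewrite ler_pdivlMr //.
  apply: le_trans (_ : (\dim W)%:R * (12 * s%:R) <= _).
    apply: ler_pM; rewrite ?ler_nat // ?ltW //.
    by rewrite mulrC -ltr_pdivrMr.
  by rewrite mulrCA; apply: ler_wpM2l => //; rewrite -natrM ler_nat mulnC.
pose E' := [seq e <- E | ~~ (e `<=` V')].
have -> : (size E - ntriples_in E V')%N = size E'.
  by rewrite size_filter /ntriples_in -(count_predC (fun e => e `<=` V') E) addKn.
have key : 3 / 4 * (size E')%:R <= \sum_(u <- V) \sum_(v <- V | v != u) cos2 (f u) (f v).
  apply: triples_cos2_sum => // [e|U UV dU].
    rewrite mem_filter => /andP[eV' eE]; have [e3 eV de] := hE e eE; split => //.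
    have /fsubsetPn[u ue uV'] := eV'; exists u => //.
    by apply: contra uV'; rewrite f0 !inE (fsubsetP eV).
  apply: leq_trans (hcap U UV dU); rewrite /ntriples_in count_filter.
  by apply: sub_count => e /andP[].
have ub : \sum_(u <- V) \sum_(v <- V | v != u) cos2 (f u) (f v) <= 4 * s%:R * (#|` V|)%:R.
  apply: le_trans (_ : \sum_(u <- V) 4 * s%:R <= _); last first.
    rewrite -sum1_size natr_sum mulr_sumr; apply: ler_sum_mem => u _.
    by rewrite mulr1.
  apply: ler_sum_mem => u uV.
  apply: le_trans (_ : \sum_(v <- V) cos2 (f u) (f v) <= _).
    rewrite big_mkcond; apply: ler_sum_mem => v _.
    by case: ifP => // _; apply: cos2_ge0.
  have [uW|uW] := boolP (u \in W).
    move: uW; rewrite -f0 => /eqP ->.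
    by rewrite big1 ?mulr_ge0 // => v _; rewrite cos20.
  (* Points of [W] are sent to 0 and contribute 0; the others form the list to which [hT]
     applies. *)
  rewrite (bigID (fun v => v \in W)) /= big1 ?add0r; last first.
    by move=> v; rewrite -f0 => /eqP ->; rewrite cos2C cos20.
  have puL : p u \in [seq p v | v <- V & v \notin W] by rewrite map_f // mem_filter uW.
  have := hT _ puL; rewrite big_map big_filter; congr (_ <= _).
  by apply: eq_bigr => v _; rewrite !fE cos2C.
have {}key := le_trans key ub.
(* The number of lost triples is at most 16/3 [s] |V|, which is less than 8/9 [lam] |V|. *)
have : 0 < (lam / 6 - s%:R) * (#|` V|)%:R by apply: mulr_gt0 => //; lra.
by have := mulr_gt0 lam0 n0; lra.
Qed.
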